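(* Let $\mathbb{K}$ be $\mathbb{R}$ or $\mathbb{C}$. Suppose that $\mathcal{X}$ is a sequentially complete Hausdorff locally convex space over $\mathbb{K}$, $V$ is a bounded subset of $\mathcal{X}$, $(a_n)_{n\ge 0}$ is a sequence in $\mathbb{K}\setminus\{0\}$ with $\liminf_{n\to\infty}|a_n|>1$, and $(b_n)_{n\ge 0}$ is a sequence in $\mathcal{X}$. Then for every sequence $(x_n)_{n\ge 0}$ in $\mathcal{X}$ satisfying $$x_{n+1}-a_nx_n-b_n\in V\quad (n\ge 0)$$ there exists a unique sequence $(y_n)_{n\ge 0}$ in $\mathcal{X}$ having both of the following properties: (i) $y_{n+1}=a_ny_n+b_n$ for all $n\ge 0$; (ii) for every real $q$ with $1<q<\liminf_{n\to\infty}|a_n|$ there exists $n_0\in\mathbb{N}$ such that $$x_n-y_n\in \frac{1}{q-1}\,\overline{\mathrm{conv}(V^b)}\quad (n\ge n_0).$$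
   Context: For a subset $A$ of a topological vector space over $\mathbb{K}$, $\overline{A}$ denotes the closure of $A$, $A^b$ the balanced hull of $A$ (the smallest balanced set containing $A$, i.e. $\{\lambda v:\lambda\in\mathbb{K},\ |\lambda|\le 1,\ v\in A\}$), and $\mathrm{conv}(A)$ the convex hull of $A$. Bounded means bounded in the sense of topological vector spaces (absorbed by every neighborhood of $0$). *)

(* Defs.v *)
From HB Require Import structures.
From mathcomp Require Import all_boot all_order all_algebra.
From mathcomp Require Import complex.
From mathcomp Require Import all_classical all_reals all_analysis.
Set Implicit Arguments.
Unset Strict Implicit.
Unset Printing Implicit Defensive.
Import Order.TTheory GRing.Theory Num.Theory.
Import numFieldNormedType.Exports.
Local Open Scope classical_set_scope.
Local Open Scope ring_scope.

Variant scalar_kind := RealScalars | ComplexScalars.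

(* The field K, which is R or C; R is any model of the real numbers. *)
Definition scalar_field (R : realType) (k : scalar_kind) : numFieldType :=
  match k with
  | RealScalars => R
  | ComplexScalars => R[i]
  end.

Definition of_real (R : realType) (k : scalar_kind) : R -> scalar_field R k :=
  match k with
  | RealScalars => fun r => r
  | ComplexScalars => fun r => (r%:C)%C
  end.
Arguments of_real {R} k r.

(* The library's norm on a field K takes its values in K, so that the modulus
   of a complex number z is Re `|z| when it is wanted as an element of R. *)
Definition modulus (R : realType) (k : scalar_kind) : scalar_field R k -> R :=
  match k with
  | RealScalars => fun r => `|r|
  | ComplexScalars => fun z => complex.Re `|z|
  end.
Arguments modulus {R k} z.

Lemma of_real_modulus (R : realType) (k : scalar_kind) (z : scalar_field R k) :
  of_real k (modulus z) = `|z|.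
Proof. by case: k z => //= z; apply/RRe_real/normr_real. Qed.

Section tvs.
Context (K : numFieldType) (X : tvsType K).

(* For K = R[i], the order of K is partial and 0 < r entails that r is real. *)
Definition absorbed (V U : set X) : Prop :=
  exists2 r : K, 0 < r & forall t : K, r <= `|t| -> V `<=` *:%R t @` U.

Definition tvs_bounded (V : set X) : Prop :=
  forall U : set X, nbhs 0 U -> absorbed V U.

(* The library does not require the uniform structure carried by a tvsType to
   be the translation-invariant one, so that Cauchy sequences are defined from
   the neighborhoods of 0 and not from the entourages. *)
Definition tvs_cauchy_seq (u : nat -> X) : Prop :=
  forall U : set X, nbhs 0 U ->
  exists N : nat, forall m n, (N <= m)%N -> (N <= n)%N -> U (u m - u n).

Definition sequentially_complete : Prop :=
  forall u : nat -> X, tvs_cauchy_seq u -> exists l : X, u @ \oo --> l.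

Definition balanced_hull (A : set X) : set X :=
  [set w | exists2 t : K, `|t| <= 1 & exists2 v, A v & w = t *: v].

Definition convex_hull (A : set X) : set X := smallest (@convex_set K X) A.

End tvs.
Arguments sequentially_complete {K} X.

(* Main.v *)
Require Import Defs.
From HB Require Import structures.
From mathcomp Require Import all_boot all_order all_algebra.
From mathcomp Require Import complex.
From mathcomp Require Import all_classical all_reals all_analysis.
Set Implicit Arguments.
Unset Strict Implicit.
Unset Printing Implicit Defensive.
Import Order.TTheory GRing.Theory Num.Theory.
Import numFieldNormedType.Exports.
Local Open Scope classical_set_scope.
Local Open Scope ring_scope.

(* Let P_n = a_0 ... a_(n-1) and d_n = x_(n+1) - a_n x_n - b_n, an element of V.
   Dividing the recurrence by P_n gives, for y_0 = x_0 + l and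
   u_n = sum_(k < n) d_k / P_(k+1), the identity x_n - y_n = P_n (u_n - l).
   If |a_k| >= q > 1 for k >= N, then sum_(n <= k < m) 1 / |P_(k+1)| is at most
   1 / (|P_n| (q - 1)) for n >= N, so that u_m - u_n lies in
   1 / (|P_n| (q - 1)) C, where C = conv(V^b) is convex, balanced and bounded.
   As |P_n| tends to infinity, u is a Cauchy sequence, and with l its limit,
   x_n - y_n lies in 1 / (q - 1) times the closure of C.  Two solutions differ
   by P_n w with w fixed; if P_n w stays in a bounded set, then w = 0. *)

(** * Tail bounds from a lower limit, and growth of powers *)

Lemma limn_einf_gt (R : realType) (u : nat -> \bar R) (l : \bar R) :
  (l < limn_einf u)%E -> exists N : nat, forall n, (N <= n)%N -> (l <= u n)%E.
Proof.
rewrite limn_einf_lim (cvg_lim _ (@cvg_einfs_sup R u))//.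
move=> /ereal_sup_gt[_ [N _ <-]] /ltW lN; exists N => n Nn.
by apply: le_trans lN _; apply: ereal_inf_lbound; exists n.
Qed.

Lemma expr_archi (R : archiRealFieldType) (q c : R) :
  1 < q -> exists n : nat, c <= q ^+ n.
Proof.
move=> q1; have q0 : 0 < q := lt_trans ltr01 q1.
have c0 : 0 < `|c| + 1 by rewrite ltr_wpDl.
have qV1 : `|q^-1| < 1 by rewrite gtr0_norm ?invr_gt0// invf_lt1.
have := cvgr0_norm_lt _ (cvg_expr qV1) _ _ => /(_ _ (`|c| + 1)^-1).
rewrite invr_gt0 => /(_ c0)[n _ /(_ _ (leqnn n))].
rewrite exprVn normfV gtr0_norm ?exprn_gt0// ltf_pV2 ?posrE ?exprn_gt0// => cq.
by exists n; rewrite (le_trans (ler_norm c))// (le_trans _ (ltW cq))// lerDl.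
Qed.

(** * Order and Archimedean property carried from the reals to the scalars *)

Section scalar_field.
Context (R : realType) (k : scalar_kind).
Implicit Types r : R.

(** As [of_real] is defined by cases on [k], a single ring morphism for both fields makes morphism
    rewriting available. *)
Lemma of_realE : exists f : {rmorphism R -> scalar_field R k}, @of_real R k = f.
Proof. by case: k; [exists idfun | exists (real_complex R)]. Qed.

Lemma ler_of_real : {mono @of_real R k : r s / r <= s}.
Proof. by case: k => //= r s; rewrite lecR. Qed.

Lemma ltr_of_real : {mono @of_real R k : r s / r < s}.
Proof. by case: k => //= r s; rewrite ltcR. Qed.

(** The Archimedean property comes from [R] through the modulus. In this form it discharges the
    hypothesis [q_archi] of the later lemmas, where [K] is a general numeric field. *)
Lemma expr_of_real_archi r (c : scalar_field R k) :
  1 < r -> exists n : nat, `|c| <= of_real k r ^+ n.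
Proof.
move=> /(@expr_archi _ r (modulus c))[n cn]; exists n.
have [f fE] := of_realE.
by rewrite -of_real_modulus fE -rmorphXn -fE ler_of_real.
Qed.

End scalar_field.

(** * Balanced convex sets, hulls and their boundedness *)

Section convex.
Context (K : numFieldType) (X : tvsType K).
Implicit Types (A B C : set X) (c : K) (v : X).

Definition balanced A := forall c v, `|c| <= 1 -> A v -> A (c *: v).

Lemma convex_setP A :
  @convex_set K X A <-> forall v w c, A v -> A w -> 0 <= c -> c <= 1 ->
    A (c *: v + (1 - c) *: w).
Proof.
split=> [cA v w c Av Aw c0 c1|cA v w c].
  have := cA v w (Itv01 c0 c1) (mem_set Av) (mem_set Aw).
  by rewrite inE.
by rewrite !inE => Av Aw; apply: cA.
Qed.

(** Combined with minimality of the hull: to see that scaling sends a hull into a convex set, it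
    suffices to check the generators. *)
Lemma convex_set_preimage_scale A c :
  @convex_set K X A -> @convex_set K X (fun v => A (c *: v)).
Proof.
move=> /convex_setP cA; apply/convex_setP => v w t Av Aw t0 t1.
by rewrite scalerDr !scalerA mulrC [c * _]mulrC -!scalerA; exact: cA.
Qed.

Lemma convex_hullP A : @convex_set K X (convex_hull A).
Proof.
apply/convex_setP => v w c Av Aw c0 c1 B [cB AB].
by apply: (convex_setP B).1 => //; [apply: Av|apply: Aw].
Qed.

Lemma sub_convex_hull A : A `<=` convex_hull A.
Proof. by move=> v Av B [_]; apply. Qed.

Lemma convex_hull_sub A B : @convex_set K X B -> A `<=` B ->
  convex_hull A `<=` B.
Proof. by move=> cB AB v; apply. Qed.

Lemma balanced_hullP A : balanced (balanced_hull A).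
Proof.
move=> c _ c1 [t t1 [v Av ->]]; exists (c * t).
  by rewrite normrM mulr_ile1.
by exists v => //; rewrite scalerA.
Qed.

Lemma sub_balanced_hull A : A `<=` balanced_hull A.
Proof.
by move=> v Av; exists 1; rewrite ?normr1//; exists v; rewrite ?scale1r.
Qed.

Lemma balanced_convex_hull A : balanced A -> balanced (convex_hull A).
Proof.
move=> bA c v c1.
apply: (@convex_hull_sub _ (fun v => convex_hull A (c *: v))).
  by apply: convex_set_preimage_scale; exact: convex_hullP.
by move=> w Aw; apply: sub_convex_hull; exact: bA.
Qed.

(** Induction on [s]: balancedness absorbs the phase of each [c i], and the moduli, divided by their
    total, are the weights of a convex combination. *)
Lemma balanced_sum C (I : Type) (s : seq I) (c : I -> K) (d : I -> X) :
  @convex_set K X C -> balanced C -> C !=set0 -> (forall i, C (d i)) ->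
  exists2 v, C v & \sum_(i <- s) c i *: d i = (\sum_(i <- s) `|c i|) *: v.
Proof.
move=> /convex_setP cC bC [v0 Cv0] Cd.
have C0 : C 0 by rewrite -(scale0r v0); apply: bC; rewrite ?normr0.
elim: s => [|i s [v Cv IH]]; first by exists 0; rewrite ?big_nil ?scaler0.
rewrite !big_cons IH; set S := \sum_(j <- s) _.
have S0 : 0 <= S by apply: sumr_ge0.
(* A zero total cannot be normalised, but then [c i] and [S] both vanish and [0] is a witness. *)
have [T0|T0] := eqVneq (`|c i| + S) 0.
  move/eqP: T0; rewrite paddr_eq0// normr_eq0 => /andP[/eqP-> /eqP->].
  by exists 0; rewrite ?normr0 ?scale0r ?addr0 ?scale0r.
have Tgt0 : 0 < `|c i| + S by rewrite lt0r T0 addr_ge0.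
exists (`|c i| / (`|c i| + S) *: ((c i / `|c i|) *: d i) +
        (1 - `|c i| / (`|c i| + S)) *: v).
  apply: cC => //; last 2 first.
  - by rewrite divr_ge0 ?addr_ge0.
  - by rewrite ler_pdivrMr// mul1r lerDl.
  (* For [c i = 0] the phase is [0 / 0 = 0], still of modulus at most 1. *)
  apply: bC => //; rewrite normrM normfV normr_id.
  by have [->|ci0] := eqVneq (c i) 0; rewrite ?normr0 ?mul0r// divff ?normr_eq0.
rewrite scalerDr !scalerA; congr (_ *: _ + _ *: _); last first.
  by rewrite mulrBr mulr1 mulrCA divff// mulr1 addrAC subrr add0r.
rewrite [(`|c i| + S) * _]mulrC divfK//.
have [->|ci0] := eqVneq (c i) 0; first by rewrite mul0r mulr0.
by rewrite mulrCA divff ?normr_eq0// mulr1.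
Qed.

Lemma balanced_sum_le C (I : Type) (s : seq I) (c : I -> K) (d : I -> X) S :
  @convex_set K X C -> balanced C -> C !=set0 -> (forall i, C (d i)) ->
  0 < S -> \sum_(i <- s) `|c i| <= S ->
  exists2 v, C v & \sum_(i <- s) c i *: d i = S *: v.
Proof.
move=> cC bC C0 Cd S0 cS; have [v Cv ->] := balanced_sum s c cC bC C0 Cd.
exists ((\sum_(i <- s) `|c i|) / S *: v).
  apply: bC => //; rewrite ger0_norm ?ler_pdivrMr ?mul1r//.
  by rewrite divr_ge0 ?sumr_ge0// ltW.
by rewrite scalerA mulrCA divff ?mulr1// gt_eqF.
Qed.

Lemma scaler_continuous c : continuous ( *:%R c : X -> X).
Proof.
move=> v; apply: (@continuous_comp X (K^o * X)%type X (fun v => (c, v))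
  (fun z => z.1 *: z.2)); last exact: scale_continuous.
by apply: (@cvg_pair _ _ _ _ (nbhs (c : K^o))); [exact: cvg_cst|exact: cvg_id].
Qed.

Lemma closure_scaler A B c : (forall v, A v -> B (c *: v)) ->
  forall v, closure A v -> closure B (c *: v).
Proof.
move=> AB v Av N /(scaler_continuous (x := v))/Av[w [Aw Nw]].
by exists (c *: w); split => //; exact: AB.
Qed.

(** Regularity gives [U0] with closure inside [U], and local convexity a convex [W] inside [U0].
    Small multiples of the balanced hull lie in [W], hence so do those of its convex hull; taking
    closures leads back to [U]. *)
Lemma bounded_hull (V U : set X) : tvs_bounded V -> nbhs 0 U ->
  exists2 e : K, 0 < e & forall c, `|c| <= e ->
    forall v, closure (convex_hull (balanced_hull V)) v -> U (c *: v).
Proof.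
move=> bV /uniform_regular[U0 U0nbhs U0U].
have [Bs Bc [Bo]] := @locally_convex K X.
move=> /(_ 0 U0 U0nbhs)[W [BW W0] WU0].
have [r r0 Vr] := bV W (open_nbhs_nbhs (conj (Bo _ BW) W0)).
exists r^-1; rewrite ?invr_gt0// => c cr v Cv; apply/U0U.
apply: closure_scaler Cv => {}v Cv; apply: WU0; move: v Cv.
apply: (@convex_hull_sub _ (fun v => W (c *: v))).
  by apply: convex_set_preimage_scale; apply: Bc; rewrite inE.
move=> _ [t t1 [v Vv ->]]; rewrite scalerA.
have [->|ct0] := eqVneq (c * t) 0; first by rewrite scale0r.
(* [W] need not be balanced: absorption, which holds for all scalars of modulus at least [r], is
   applied to the inverse of [c * t]. *)
have [|w Ww <-] := Vr (c * t)^-1 _ v Vv.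
  2: by rewrite scalerA divff// scale1r.
rewrite normfV -[r]invrK lef_pV2 ?posrE ?invr_gt0 ?normr_gt0// normrM.
by rewrite (le_trans _ cr)// ler_piMr.
Qed.

End convex.

(** * Solution of the linear recurrence and growth of the coefficient products *)

Section recurrence.
Context (K : numFieldType) (X : tvsType K) (a : nat -> K).
Hypothesis a_neq0 : forall n, a n != 0.
Implicit Types (f z : nat -> X) (y : X).

Local Notation P n := (\prod_(i < n) a i).

Lemma prod_coef_neq0 n : P n != 0.
Proof. by apply/prodf_neq0. Qed.

(** Variation of constants: dividing [z n.+1 = a n *: z n + f n] by [P n.+1] makes the recurrence
    telescope. *)
Definition recurrence_solution y f n :=
  P n *: (y + \sum_(0 <= k < n) (P k.+1)^-1 *: f k).

Lemma recurrence_solution0 y f : recurrence_solution y f 0 = y.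
Proof. by rewrite /recurrence_solution big_ord0 big_geq// addr0 scale1r. Qed.

Lemma recurrence_solutionS y f n : recurrence_solution y f n.+1 =
  a n *: recurrence_solution y f n + f n.
Proof.
rewrite /recurrence_solution scalerA big_nat_recr//= addrA scalerDr.
by rewrite scalerA divff ?prod_coef_neq0// scale1r big_ord_recr/= mulrC.
Qed.

Lemma recurrence_solution_unique f z :
  (forall n, z n.+1 = a n *: z n + f n) -> z =1 recurrence_solution (z 0%N) f.
Proof.
move=> zS; elim=> [|n IH]; first by rewrite recurrence_solution0.
by rewrite zS IH recurrence_solutionS.
Qed.

Context (q : K) (N : nat).
Hypotheses (q_gt1 : 1 < q) (a_ge : forall n, (N <= n)%N -> q <= `|a n|).

Let q1_gt0 : 0 < q - 1. Proof. by rewrite subr_gt0. Qed.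

Let q_gt0 : 0 < q. Proof. exact: lt_trans ltr01 q_gt1. Qed.

(* |a_k| >= q makes (q - 1) / |P_(k+1)| at most 1 / |P_k| - 1 / |P_(k+1)|, so
   that the sum telescopes. *)
Lemma sum_inv_prod_coef_le n m : (N <= n)%N ->
  \sum_(n <= k < m) `|(P k.+1)^-1| <= `|P n|^-1 / (q - 1).
Proof.
move=> Nn; have [mn|/ltnW nm] := leqP m n.
  by rewrite big_geq// divr_ge0 ?invr_ge0// ltW.
rewrite ler_pdivlMr// mulr_suml.
apply: (@le_trans _ _ (- \sum_(n <= k < m) (`|P k.+1|^-1 - `|P k|^-1))).
  rewrite -sumrN; apply: ler_sum_nat => k /andP[nk _].
  rewrite opprB mulrBr mulr1 normfV lerD2r big_ord_recr/= normrM invfM.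
  rewrite -mulrA ler_piMr ?invr_ge0// mulrC ler_pdivrMr ?normr_gt0// mul1r.
  by rewrite a_ge// (leq_trans Nn).
by rewrite telescope_sumr// opprB lerBlDr lerDl invr_ge0.
Qed.

(** From [N] on, the ratio of [q ^+ n] to the modulus of [P n] does not increase, so it is enough
    that [q ^+ n * e] exceeds its value at [N]. *)
Lemma inv_prod_coef_to0 (e : K) : (forall c : K, exists n, `|c| <= q ^+ n) ->
  0 < e -> exists2 M, (N <= M)%N & forall n, (M <= n)%N -> `|P n|^-1 <= e.
Proof.
move=> q_archi e0; have [j] := q_archi (q ^+ N / `|P N| / e).
have PN0 n : 0 < `|P n| by rewrite normr_gt0 prod_coef_neq0.
rewrite ger0_norm; last first.
  by rewrite !divr_ge0 ?exprn_ge0 ?(ltW e0) ?(ltW q_gt0).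
move=> jP; exists (maxn N j) => [|n]; first exact: leq_maxl.
rewrite geq_max => /andP[Nn jn].
have : q ^+ n / `|P n| <= q ^+ N / `|P N|.
  rewrite -(subnK Nn); elim: (n - N)%N => [|i IH]; first by rewrite add0n.
  apply: le_trans IH; rewrite addSn exprSr big_ord_recr/= normrM invfM.
  rewrite mulrACA ler_piMr ?divr_ge0 ?exprn_ge0 ?(ltW q_gt0)//.
  by rewrite ler_pdivrMr ?normr_gt0// mul1r a_ge// leq_addl.
move: jP; rewrite ler_pdivrMr// => jP /le_trans/(_ jP).
have qn : q ^+ j * e <= q ^+ n * e by rewrite ler_pM2r// ler_weXn2l// ltW.
by move=> /le_trans/(_ qn); rewrite ler_pM2l// exprn_gt0.
Qed.

End recurrence.

(** * Convergence of the error series, its bound, and uniqueness *)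

Section approximate_solution.
Context (K : numFieldType) (X : tvsType K) (a : nat -> K).
Hypothesis a_neq0 : forall n, a n != 0.
Context (C : set X).
Hypotheses (C_convex : @convex_set K X C) (C_balanced : balanced C).
Hypothesis C_bounded : forall U : set X, nbhs 0 U ->
  exists2 e : K, 0 < e & forall c, `|c| <= e ->
    forall v, closure C v -> U (c *: v).

Local Notation P n := (\prod_(i < n) a i).

Context (q : K) (N : nat).
Hypotheses (q_gt1 : 1 < q) (a_ge : forall n, (N <= n)%N -> q <= `|a n|).

Let q1_gt0 : 0 < q - 1. Proof. by rewrite subr_gt0. Qed.

Section existence.
Context (d : nat -> X).
Hypothesis Cd : forall n, C (d n).

Local Notation u := (fun n => \sum_(0 <= k < n) (P k.+1)^-1 *: d k).

Lemma error_series_tail n m : (N <= n <= m)%N ->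
  exists2 v, C v & u m - u n = (`|P n|^-1 / (q - 1)) *: v.
Proof.
move=> /andP[Nn nm]; rewrite (big_cat_nat _ nm)//= addrAC subrr add0r.
apply: balanced_sum_le => //; first by exists (d 0).
  by rewrite divr_gt0// invr_gt0 normr_gt0 prod_coef_neq0.
exact: sum_inv_prod_coef_le a_ge _ _ Nn.
Qed.

Lemma error_series_cvg : (forall c : K, exists n, `|c| <= q ^+ n) ->
  sequentially_complete X -> exists l : X, u @ \oo --> l.
Proof.
move=> q_archi; apply=> U /C_bounded[e e0 Ue].
(* The tolerance [e * (q - 1)] compensates the division by [q - 1] in the tail coefficient. *)
have [M NM Me] :=
  inv_prod_coef_to0 a_neq0 q_gt1 a_ge q_archi (mulr_gt0 e0 q1_gt0).
exists M => m n Mm Mn.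
(* Both signs are needed: the Cauchy condition does not order [m] and [n], and [U] need not be
   symmetric. *)
have small i v : (M <= i)%N -> C v -> U ((`|P i|^-1 / (q - 1)) *: v) /\
    U (- ((`|P i|^-1 / (q - 1)) *: v)).
  move=> Mi /(@subset_closure _ C)Cv; rewrite -scaleNr.
  have ie : `| `|P i|^-1 / (q - 1)| <= e.
    rewrite ger0_norm; last by rewrite divr_ge0 ?invr_ge0// ltW.
    by rewrite ler_pdivrMr// Me.
  by split; apply: Ue; rewrite ?normrN.
have [mn|/ltnW nm] := leqP m n.
  have [|v Cv umn] := @error_series_tail m n; first by rewrite (leq_trans NM).
  by rewrite -opprB umn; apply: (small m v _ _).2.
have [|v Cv ->] := @error_series_tail n m; first by rewrite (leq_trans NM).
exact: (small n v _ _).1.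
Qed.

Lemma error_series_bound (l : X) n : u @ \oo --> l -> (N <= n)%N ->
  closure C (((q - 1) * P n) *: (u n - l)).
Proof.
move=> ul Nn.
have cu : ((q - 1) * P n) *: (u n - u m) @[m --> \oo] -->
    ((q - 1) * P n) *: (u n - l).
  have cf : continuous (fun w : X => ((q - 1) * P n) *: (u n - w)).
    move=> w; apply: (@continuous_comp X X X (fun w => u n - w)
      ( *:%R ((q - 1) * P n))); last exact: scaler_continuous.
    apply: (@continuous_comp X (X * X)%type X (fun w => (u n, w))
      (fun z => z.1 - z.2)); last exact: sub_continuous.
    by apply: cvg_pair; [exact: cvg_cst|exact: cvg_id].
  exact: (cvg_comp _ _ ul (cf l)).
apply: (closed_cvg (closure C) (@closed_closure _ C) _ _ cu).
exists n => // m /= nm; apply: subset_closure.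
have [|v Cv unm] := @error_series_tail n m; first by rewrite Nn.
(* The remaining scalar is [P n] divided by its modulus, up to sign, and balancedness absorbs it. *)
rewrite -[X in _ *: X]opprB unm -scaleNr scalerA; apply: C_balanced => //.
have Pn0 : `|P n| != 0 by rewrite normr_eq0 prod_coef_neq0.
rewrite mulrN normrN [(q - 1) * _]mulrC mulrACA divff ?gt_eqF// mulr1.
by rewrite normrM normfV normr_id divff.
Qed.

End existence.

Lemma hausdorff_eq0 (w : X) : hausdorff_space X ->
  (forall U : set X, nbhs 0 U -> U w) -> w = 0.
Proof.
move=> hX wU; apply: hX => A B wA B0; exists w; split.
  exact: nbhs_singleton.
exact: wU.
Qed.

(** The initial difference is [(P M)^-1 *: (y M - z M)], where [y M - z M] is a difference of two
    points of [c] times the closure of [C]. Large [M] puts it in any neighborhood of 0. *)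
Lemma solutions_close_eq (y z f x : nat -> X) (c : K) :
  (forall c : K, exists n, `|c| <= q ^+ n) -> hausdorff_space X -> 0 < c ->
  (forall n, y n.+1 = a n *: y n + f n) ->
  (forall n, z n.+1 = a n *: z n + f n) ->
  (forall n, (N <= n)%N -> [set c *: v | v in closure C] (x n - y n)) ->
  (forall n, (N <= n)%N -> [set c *: v | v in closure C] (x n - z n)) ->
  y = z.
Proof.
move=> q_archi hX c0 ys zs xy xz.
have ysol := recurrence_solution_unique a_neq0 ys.
have zsol := recurrence_solution_unique a_neq0 zs.
suff /eqP : y 0%N - z 0%N = 0.
  by rewrite subr_eq0 => /eqP yz0; apply/funext => n; rewrite ysol zsol yz0.
apply: hausdorff_eq0 => // U U0.
(* Continuity of subtraction splits [U], so that the two errors are made small separately. *)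
have : nbhs ((0, 0) : X * X) [set w | U (w.1 - w.2)].
  by apply: (@sub_continuous X (0, 0)); rewrite /= subrr.
move=> [[U1 U2] /= [U10 U20] U12].
have [e e0 Ue] := C_bounded (filterI U10 U20).
have [M NM Me] := inv_prod_coef_to0 a_neq0 q_gt1 a_ge q_archi (divr_gt0 e0 c0).
have [v Cv xyM] := xy M NM; have [w Cw xzM] := xz M NM.
have small : `|(P M)^-1 * c| <= e.
  by rewrite normrM normfV (gtr0_norm c0) -ler_pdivlMr// Me.
have -> : y 0%N - z 0%N = (P M)^-1 * c *: w - (P M)^-1 * c *: v.
  rewrite -!scalerA xyM xzM -scalerBr.
  rewrite (_ : x M - z M - _ = y M - z M); last by rewrite opprB addrC subrKA.
  rewrite (ysol M) (zsol M) /recurrence_solution -scalerBr.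
  by rewrite scalerA mulVf ?prod_coef_neq0// scale1r opprD addrACA subrr addr0.
apply: (U12 (_, _)); split.
  exact: (Ue _ small _ Cw).1.
exact: (Ue _ small _ Cv).2.
Qed.

End approximate_solution.

(** * Existence and uniqueness of the exact solution close to [x] *)

Theorem theorem2p3 (R : realType) (k : scalar_kind)
    (X : tvsType (scalar_field R k))
    (X_hausdorff : hausdorff_space X)
    (X_complete : sequentially_complete X)
    (V : set X) (V_bounded : tvs_bounded V)
    (a : nat -> scalar_field R k) (a_neq0 : forall n, a n != 0)
    (a_liminf : (1 < limn_einf (fun n => (modulus (a n))%:E))%E)
    (b : nat -> X) (x : nat -> X)
    (x_approx : forall n, V (x n.+1 - a n *: x n - b n)) :
  exists! y : nat -> X,
    (forall n, y n.+1 = a n *: y n + b n) /\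
    (forall q : R, 1 < q ->
       (q%:E < limn_einf (fun n => (modulus (a n))%:E))%E ->
       exists n0 : nat, forall n, (n0 <= n)%N ->
         [set of_real k (1 / (q - 1)) *: v
            | v in closure (convex_hull (balanced_hull V))] (x n - y n)).
Proof.
set C := convex_hull (balanced_hull V).
have C_convex : @convex_set _ X C by exact: convex_hullP.
have C_balanced : balanced C.
  by apply: balanced_convex_hull; exact: balanced_hullP.
have C_bounded := fun U => @bounded_hull _ X V U V_bounded.
pose d n := x n.+1 - a n *: x n - b n.
have Cd n : C (d n).
  exact: (sub_convex_hull (sub_balanced_hull (x_approx n))).
have [f fE] := @of_realE R k.
have fB1 q : f (q - 1) = f q - 1 by rewrite rmorphB rmorph1.
have f_gt1 q : 1 < q -> 1 < f q.
  by move=> q1; rewrite -(rmorph1 f) -fE ltr_of_real.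
have f_archi q : 1 < q ->
    forall c : scalar_field R k, exists n, `|c| <= f q ^+ n.
  by move=> q1 c; rewrite -fE; exact: expr_of_real_archi.
have a_ge q : (q%:E < limn_einf (fun n => (modulus (a n))%:E))%E ->
    exists N, forall n, (N <= n)%N -> f q <= `|a n|.
  move=> /limn_einf_gt[N aN]; exists N => n /aN.
  by rewrite lee_fin -of_real_modulus -fE ler_of_real.
(* The midpoint of 1 and the lower limit if that is finite, and 2 if it is infinite. *)
have [q /andP[q1 qa]] : exists q : R, (1 < q) &&
    (q%:E < limn_einf (fun n => (modulus (a n))%:E))%E.
  move: a_liminf; case: limn_einf => [r||//] r1.
    exists ((1 + r) / 2); rewrite !lte_fin in r1 *.
    by rewrite midf_lt//= midf_lt.
  by exists 2; rewrite ltry ltr1n.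
have [N aN] := a_ge _ qa.
have [l ul] := error_series_cvg a_neq0 C_convex C_balanced C_bounded
  (f_gt1 _ q1) aN Cd (f_archi _ q1) X_complete.
pose y := recurrence_solution a (x 0%N + l) b.
have yS n : y n.+1 = a n *: y n + b n by exact: recurrence_solutionS.
(* Seen as an exact solution with forcing term [b n + d n], [x] is given by the same closed formula
   as [y]. *)
have xS n : x n.+1 = a n *: x n + (b n + d n).
  by rewrite /d [b n + _]addrC subrK addrC subrK.
have xy n : x n - y n = \prod_(i < n) a i *:
    (\sum_(0 <= j < n) (\prod_(i < j.+1) a i)^-1 *: d j - l).
  rewrite (recurrence_solution_unique a_neq0 xS) /y /recurrence_solution.
  rewrite -scalerBr; congr (_ *: _).
  under eq_bigr do rewrite scalerDr.
  rewrite big_split/= -[x 0%N + l + _]addrA opprD addrACA subrr add0r.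
  by rewrite [l + _]addrC opprD addrACA subrr add0r.
have y_close p : 1 < p ->
    (p%:E < limn_einf (fun n => (modulus (a n))%:E))%E ->
    exists n0 : nat, forall n, (n0 <= n)%N ->
      [set of_real k (1 / (p - 1)) *: v | v in closure C] (x n - y n).
  (* The limit [l], obtained from the one value [q], serves every [p]: only the threshold [M]
     changes. *)
  move=> p1 /a_ge[M aM]; exists M => n Mn.
  exists ((f p - 1) * \prod_(i < n) a i *:
    (\sum_(0 <= j < n) (\prod_(i < j.+1) a i)^-1 *: d j - l)).
    exact: (error_series_bound a_neq0 C_convex C_balanced (f_gt1 _ p1) aM Cd
      ul Mn).
  rewrite xy scalerA mulrA fE -fB1 -rmorphM mul1r mulVf ?rmorph1 ?mul1r//.
  by rewrite gt_eqF// subr_gt0.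
exists y; split=> // z [zS z_close].
have [n1 close1] := y_close q q1 qa; have [n2 close2] := z_close q q1 qa.
have qq1 : 0 < of_real k (1 / (q - 1)).
  by rewrite fE -(rmorph0 f) -fE ltr_of_real divr_gt0// subr_gt0.
(* Past the largest threshold, the growth of [a] and both closeness bounds for [q] hold together. *)
apply: (solutions_close_eq (N := maxn N (maxn n1 n2)) (x := x) (f := b) a_neq0
  C_bounded (f_gt1 _ q1) _ (f_archi _ q1) X_hausdorff qq1 yS zS) => n;
  rewrite !geq_max => /and3P[Nn n1n n2n].
- exact: aN.
- exact: close1.
- exact: close2.
Qed.
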